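(* Consider the Singleton Search Engine Game with the proportional selection rule. If $\beta>\frac{6}{\sqrt N}$, there are instances with $K=2$ engines and Price of Anarchy $\Omega(\sqrt N)$. That is, there are constants $c>0$ and $N_0$ such that for all $N\ge N_0$ and all $\beta\in[0,1]$ with $\beta>\frac{6}{\sqrt N}$, there is a distribution $\gamma$ on $N$ pages for which the game with $K=2$ engines and parameter $\beta$ has pure Price of Anarchy at least $c\sqrt N$.
   Context: Proportional selection rule: $f_i(\mathbf q)=\frac{q_i}{\sum_j q_j}$ for $\mathbf q\in[0,1]^K\setminus\{\mathbf 0\}$, and $f_i(\mathbf 0)=1/K$. Singleton Search Engine Game: there are $K$ engines, $N$ pages $\{1,\dots,N\}$, and a probability distribution $\gamma$ on pages with $\gamma(n)>0$ for all $n$; a user of type $n$ (probability $\gamma(n)$) desires exactly page $n$ and looks only at the first displayed page. A pure strategy of engine $i$ is a probability vector $\mathbf q_i=(q_i(n))_{n=1}^N$, where $q_i(n)$ is the probability of displaying page $n$. With $\mathbf q(n)=(q_1(n),\dots,q_K(n))$ and parameter $\beta\in[0,1]$, engine $i$'s payoff is $\sum_n\gamma(n)f_i(\mathbf q(n))(\beta+(1-\beta)q_i(n))$, and the welfare is $W=\sum_n\gamma(n)\sum_i f_i(\mathbf q(n))q_i(n)$. A pure Nash equilibrium is a profile of pure strategies from which no engine can strictly improve her payoff by a unilateral deviation to another pure strategy. With $\mathrm{OPT}$ a welfare-maximizing strategy profile, the pure Price of Anarchy is the supremum of $W(\mathrm{OPT})/W(\mathbf{\mathcal D})$ over pure Nash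 equilibria $\mathbf{\mathcal D}$. *)

(* Defs.v *)
From mathcomp Require Import all_boot all_order all_algebra.
From mathcomp Require Import classical_sets reals constructive_ereal ereal.

Set Implicit Arguments.
Unset Strict Implicit.
Unset Printing Implicit Defensive.

Import Order.TTheory GRing.Theory Num.Theory.

Local Open Scope ring_scope.

Section SingletonSearchEngineGame.
Context {R : realType}.

Definition is_distribution (N : nat) (p : 'I_N -> R) : Prop :=
  (forall n, 0 <= p n) /\ \sum_n p n = 1.

Definition proportional (K : nat) (q : 'I_K -> R) (i : 'I_K) : R :=
  if [forall j, q j == 0] then K%:R^-1 else q i / \sum_j q j.

(* [D i n] is the probability with which engine [i] displays page [n]. *)
Definition is_profile (K N : nat) (D : 'I_K -> 'I_N -> R) : Prop :=
  forall i, is_distribution (D i).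

Definition payoff (K N : nat) (gamma : 'I_N -> R) (beta : R)
    (D : 'I_K -> 'I_N -> R) (i : 'I_K) : R :=
  \sum_n gamma n * proportional (D^~ n) i * (beta + (1 - beta) * D i n).

Definition welfare (K N : nat) (gamma : 'I_N -> R)
    (D : 'I_K -> 'I_N -> R) : R :=
  \sum_n gamma n * \sum_i proportional (D^~ n) i * D i n.

Definition is_pure_nash (K N : nat) (gamma : 'I_N -> R) (beta : R)
    (D : 'I_K -> 'I_N -> R) : Prop :=
  is_profile D /\
  forall (i : 'I_K) (s : 'I_N -> R), is_distribution s ->
    payoff gamma beta [eta D with i |-> s] i <= payoff gamma beta D i.

Definition is_optimal (K N : nat) (gamma : 'I_N -> R)
    (D : 'I_K -> 'I_N -> R) : Prop :=
  is_profile D /\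
  forall D' : 'I_K -> 'I_N -> R, is_profile D' ->
    welfare gamma D' <= welfare gamma D.

(* The supremum is taken in the extended reals, so that it is -oo, and not a
   junk real value, when there is no pure Nash equilibrium. The denominators
   are positive as soon as K > 0 and gamma is positive. *)
Definition pure_PoA (K N : nat) (gamma : 'I_N -> R) (beta : R) : \bar R :=
  ereal_sup [set r : \bar R | exists OPT D : 'I_K -> 'I_N -> R,
    [/\ is_optimal gamma OPT, is_pure_nash gamma beta D &
        r = (welfare gamma OPT / welfare gamma D)%:E]]%classic.

End SingletonSearchEngineGame.

Arguments pure_PoA {R} K {N} gamma beta.

(* Main.v *)
(** Work backwards from the equilibrium. If both engines play the same positive
    [q] with [(1 - beta) q <= beta], the payoff of an engine on a page is
    concave in her own probability, so [q] is an equilibrium as soon as the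
    marginal payoffs [gamma (beta + 3 (1 - beta) q) / (4 q)] agree on all pages;
    this determines [gamma] from [q] up to normalization. With [r = sqrt N], put
    [q = 1 / r] on one page and [q = 1 / (r (r + 1))] on the others. As
    [6 / r < beta], [gamma] is then proportional to [q] up to a factor [3 / 2],
    so the equilibrium welfare [\sum gamma q] is of order [1 / N], while the
    optimum is at least the largest [gamma], of order [1 / r]. *)
Require Import Defs.
From mathcomp Require Import all_boot all_order all_algebra.
From mathcomp Require Import classical_sets reals constructive_ereal ereal.
From mathcomp Require Import ring lra.
Import Order.TTheory GRing.Theory Num.Theory.
Local Open Scope ring_scope.

(** * Weighted averages under the proportional rule *)

Section Proportional.
Context {R : realType} {K : nat}.
Implicit Types q : 'I_K -> R.

Lemma proportional_gt0E {q} i :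
  0 < \sum_j q j -> proportional q i = q i / \sum_j q j.
Proof.
rewrite /proportional; case: ifP => // /forallP q0.
by rewrite big1 ?ltxx // => j _; apply/eqP.
Qed.

Lemma proportional_ge0 {q} i : (forall j, 0 <= q j) -> 0 <= proportional q i.
Proof.
move=> q0; rewrite /proportional; case: ifP => _; first by rewrite invr_ge0.
by rewrite divr_ge0 // sumr_ge0.
Qed.

Lemma sum_proportional {q} :
  (0 < K)%N -> (forall j, 0 <= q j) -> \sum_i proportional q i = 1.
Proof.
move=> K0 q0; rewrite /proportional; case: (boolP [forall j, _]) => [_|].
  by rewrite sumr_const card_ord -[_^-1 *+ _]mulr_natr mulVf // pnatr_eq0 -lt0n.
move=> /forallPn[j qj]; rewrite -mulr_suml mulfV // psumr_neq0 //.
by apply/hasP; exists j; rewrite ?mem_index_enum //= lt_def qj q0.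
Qed.

(** A weighted average of numbers in [0, 1]: thanks to the default [1 / K], the weights sum to 1
    even at [q = 0]. *)
Lemma sum_proportionalM_le1 {q} : (0 < K)%N ->
  (forall j, 0 <= q j <= 1) -> \sum_i proportional q i * q i <= 1.
Proof.
move=> K0 q01; have q0 j : 0 <= q j by case/andP: (q01 j).
rewrite -(sum_proportional K0 q0); apply: ler_sum => i _.
by rewrite ler_piMr ?proportional_ge0 //; case/andP: (q01 i).
Qed.

Lemma sum_proportionalM_le_sum {q} :
  (forall j, 0 <= q j) -> \sum_i proportional q i * q i <= \sum_i q i.
Proof.
move=> q0; apply: ler_sum => i _; rewrite ler_piMl //.
have K0 : (0 < K)%N by apply: leq_ltn_trans (ltn_ord i).
rewrite -(sum_proportional K0 q0) (bigD1 i) //= lerDl sumr_ge0 // => j _.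
exact: proportional_ge0.
Qed.

End Proportional.

(** * Symmetric equilibria and optimal welfare for two engines *)

Section Game.
Context {R : realType} {N : nat}.
Implicit Types (gamma q s : 'I_N -> R) (n : 'I_N).

Lemma distribution_le1 s n : is_distribution s -> 0 <= s n <= 1.
Proof.
case=> s0 <-; rewrite s0 (bigD1 n) //= lerDl sumr_ge0 // => i _; exact: s0.
Qed.

Lemma distribution_pure n : @is_distribution R N (fun m => (m == n)%:R).
Proof.
split=> [m|]; first exact: ler0n.
by rewrite (bigD1 n) //= eqxx big1 ?addr0 // => m /negPf->.
Qed.

Lemma proportional_deviation q s (i : 'I_2) n :
  0 < q n -> 0 <= s n ->
  proportional ([eta (fun _ => q) with i |-> s]^~ n) i = s n / (s n + q n).
Proof.
move=> q0 s0.
have E : \sum_j [eta (fun=> q) with i |-> s] j n = s n + q n.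
  rewrite (bigD1 i) //= eqxx; congr (_ + _).
  rewrite (eq_bigr (fun=> q n)) => [|j /negPf->//].
  by rewrite sumr_const cardC1 card_ord.
by rewrite proportional_gt0E E /= ?eqxx // ltr_wpDl.
Qed.

Lemma proportional_symmetric (x : R) (i : 'I_2) :
  proportional (fun=> x) i = 2^-1.
Proof.
rewrite /proportional; case: ifPn => // /forallPn[_ x0].
by rewrite sumr_const card_ord; field.
Qed.

Lemma welfare_symmetric gamma q :
  welfare gamma (fun _ : 'I_2 => q) = \sum_n gamma n * q n.
Proof.
apply: eq_bigr => n _; congr (_ * _).
by rewrite !big_ord_recl big_ord0 !proportional_symmetric; field.
Qed.

(* The tangent at [x = q] of the payoff against [q], whose gap is
   [(beta - (1 - beta) q) (x - q)^2 / (4 q (x + q))]. *)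
Lemma page_payoff_le_tangent (beta q x : R) :
  0 < q -> 0 <= x -> (1 - beta) * q <= beta ->
  x / (x + q) * (beta + (1 - beta) * x) <=
  2^-1 * (beta + (1 - beta) * q)
  + (beta + 3 * (1 - beta) * q) / (4 * q) * (x - q).
Proof.
move=> q0 x0 hb; rewrite -subr_ge0.
have xq : 0 < x + q by rewrite ltr_wpDl.
rewrite (_ : _ - _ =
  (beta - (1 - beta) * q) * (x - q) ^+ 2 / (4 * q * (x + q))).
  by rewrite divr_ge0 ?[0 <= _ * _ ^+ 2]mulr_ge0 ?sqr_ge0 ?subr_ge0 //
    ltW // !mulr_gt0.
by field; rewrite !lt0r_neq0.
Qed.

Lemma symmetric_nash gamma q (beta C : R) :
  is_distribution q -> (forall n, 0 < q n) ->
  (forall n, 0 <= gamma n) -> (forall n, (1 - beta) * q n <= beta) ->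
  (forall n, gamma n * (beta + 3 * (1 - beta) * q n) = C * q n) ->
  is_pure_nash gamma beta (fun _ : 'I_2 => q).
Proof.
move=> dq q0 g0 hb hC; split=> // i s ds.
(* Add the linear terms of the tangents: their common slope [C / 4] makes them cancel, as [s] and
   [q] both have mass 1. It then suffices to compare page by page. *)
have -> : payoff gamma beta (fun=> q) i =
    \sum_n (gamma n * (2^-1 * (beta + (1 - beta) * q n))
            + C / 4 * (s n - q n)).
  rewrite big_split /= -mulr_sumr sumrB ds.2 dq.2 subrr mulr0 addr0.
  by apply: eq_bigr => n _; rewrite proportional_symmetric mulrA.
apply: ler_sum => n _; rewrite proportional_deviation ?ds.1 //= eqxx.
have -> : C / 4 = gamma n * ((beta + 3 * (1 - beta) * q n) / (4 * q n)).
  by rewrite mulrA hC; field; rewrite lt0r_neq0.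
rewrite -[_ * _ * (s n - _)]mulrA -mulrDr -mulrA ler_wpM2l //.
exact: page_payoff_le_tangent (q0 n) (ds.1 n) (hb n).
Qed.

(** The page welfares [w n] are nonnegative, each at most 1, and sum to at most 2, the number of
    engines. The best use of this budget is one unit on [n0] and the other on [n1]. *)
Lemma welfare_le gamma (D : 'I_2 -> 'I_N -> R) n0 n1 :
  (forall n, n != n0 -> gamma n <= gamma n1) ->
  0 <= gamma n1 <= gamma n0 -> is_profile D ->
  welfare gamma D <= gamma n0 + gamma n1.
Proof.
move=> g1 /andP[g10 g01] pD; rewrite /welfare.
set w := fun n => \sum_i proportional (D^~ n) i * D i n.
have D0 n j : 0 <= D j n by case: (pD j).
have w0 n : 0 <= w n.
  by apply: sumr_ge0 => i _; rewrite mulr_ge0 ?proportional_ge0.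
have w1 : w n0 <= 1.
  by apply: sum_proportionalM_le1 => // j; apply: distribution_le1.
have w2 : \sum_n w n <= 2.
  apply: (@le_trans _ _ (\sum_n \sum_(i < 2) D i n)).
    by apply: ler_sum => n _; apply: sum_proportionalM_le_sum.
  rewrite exchange_big /= (eq_bigr (fun=> 1)) => [|i _]; last by case: (pD i).
  by rewrite sumr_const card_ord.
apply: (@le_trans _ _ ((gamma n0 - gamma n1) * w n0
                        + gamma n1 * \sum_n w n)).
  rewrite [\sum_n w n](bigD1 n0) //= [leLHS](bigD1 n0) //=.
  rewrite mulrDr addrA -mulrDl subrK lerD2l mulr_sumr.
  by apply: ler_sum => n nn0; rewrite ler_wpM2r ?g1 ?w0.
have := ler_wpM2l g10 w2; have := ler_wpM2l (_ : 0 <= gamma n0 - gamma n1) w1.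
by rewrite subr_ge0 => /(_ g01); lra.
Qed.

(** The upper bound [welfare_le] is attained when each engine always displays its own one of the two
    best pages. *)
Lemma best_two_pages_optimal gamma n0 n1 :
  n0 != n1 -> (forall n, n != n0 -> gamma n <= gamma n1) ->
  0 <= gamma n1 <= gamma n0 ->
  exists2 OPT : 'I_2 -> 'I_N -> R, is_optimal gamma OPT &
    welfare gamma OPT = gamma n0 + gamma n1.
Proof.
move=> n01 g1 g10.
pose D (i : 'I_2) n : R := (n == if i == ord0 then n0 else n1)%:R.
have WD : welfare gamma D = gamma n0 + gamma n1.
  have sumD n : \sum_j D j n = (n == n0)%:R + (n == n1)%:R.
    by rewrite !big_ord_recl big_ord0 addr0.
  have w n : \sum_i proportional (D^~ n) i * D i n =
      (n == n0)%:R + (n == n1)%:R.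
    have [nn|nn] := boolP ((n == n0) || (n == n1)).
      have E : \sum_j D j n = 1.
        by case/orP: nn sumD => /eqP-> ->; rewrite ?(eq_sym n1) eqxx
          (negPf n01) ?addr0 ?add0r.
      rewrite -sumD; apply: eq_bigr => i _.
      rewrite proportional_gt0E E ?divr1 // /D.
      by case: (n == _); rewrite ?mulr1 ?mulr0.
    (* On a page nobody displays, the default share is multiplied by a zero probability. *)
    case/norP: nn => /negPf nn0 /negPf nn1.
    by rewrite !big_ord_recl big_ord0 /D /= nn0 nn1 !mulr0 !addr0.
  rewrite /welfare (bigD1 n0) //= (bigD1 n1) ?(eq_sym n1) //=.
  rewrite [X in _ + (_ + X)]big1 => [|n /andP[/negPf nn0 /negPf nn1]].
    by rewrite !w !eqxx (eq_sym n1) (negPf n01) !addr0 add0r !mulr1.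
  by rewrite w nn0 nn1 addr0 mulr0.
exists D => //; split=> [i|D' pD']; first exact: distribution_pure.
by rewrite WD; apply: welfare_le.
Qed.

Lemma pure_PoA_ge gamma (beta : R) (OPT D : 'I_2 -> 'I_N -> R) :
  is_optimal gamma OPT -> is_pure_nash gamma beta D ->
  ((welfare gamma OPT / welfare gamma D)%:E <= pure_PoA 2 gamma beta)%E.
Proof. by move=> hO hD; apply: ereal_sup_ubound; exists OPT, D. Qed.

End Game.

Theorem proposition5p3 (R : realType) :
  exists (c : R) (N0 : nat), 0 < c /\
    forall (N : nat) (beta : R), (N0 <= N)%N ->
      0 <= beta <= 1 -> 6 / Num.sqrt N%:R < beta ->
      exists gamma : 'I_N -> R,
        [/\ is_distribution gamma,
            (forall n, 0 < gamma n) &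
            ((c * Num.sqrt N%:R)%:E <= pure_PoA 2 gamma beta)%E].
Proof.
(* The ratio [q ord0 / d ord0] is at least [2 / (3 * r * beta)], and [\sum_n q n ^+ 2 / d n] is at
   most [2 / (r ^+ 2 * beta)]; dividing gives [r / 3]. Two pages are needed for [n1] below. *)
exists (3^-1), 2%N; split=> [|[|[|m]]// beta _ /andP[_ b1]]; first by lra.
set r := Num.sqrt _ => hb.
have r0 : 0 < r by rewrite sqrtr_gt0 ltr0n.
have rr : r ^+ 2 = m.+2%:R by rewrite sqr_sqrtr.
have b0 : 0 < beta by apply: lt_trans hb; rewrite divr_gt0.
(* The mass [1 - 1 / r] left by the first page, shared equally among the other [r ^+ 2 - 1]
   pages. *)
pose t : R := (r * (r + 1))^-1.
pose q (n : 'I_m.+2) : R := if n == ord0 then r^-1 else t.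
have r10 : 0 < r + 1 by lra.
have t0 : 0 < t by rewrite invr_gt0 mulr_gt0.
have tr : t <= r^-1.
  by rewrite lef_pV2 ?posrE ?mulr_gt0 // ler_peMr ?(ltW r0) // lerDr ltW.
have q0 n : 0 < q n by rewrite /q; case: ifP => _ //; rewrite invr_gt0.
have qr n : q n <= r^-1 by rewrite /q; case: ifP.
have rest : m.+1%:R = (r - 1) * (r + 1) :> R.
  by rewrite -[m.+1%:R](addrK 1) natr1 -rr; ring.
have dq : is_distribution q.
  split=> [n|]; first exact: ltW.
  rewrite big_ord_recl /= (eq_bigr (fun=> t)) //.
  by rewrite sumr_const card_ord -mulr_natl rest /q eqxx /t; field;
    rewrite !lt0r_neq0.
have q2 : \sum_n q n ^+ 2 <= 2 / r ^+ 2.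
  rewrite big_ord_recl /= (eq_bigr (fun=> t ^+ 2)) // sumr_const card_ord.
  rewrite -[t ^+ 2 *+ _]mulr_natl rest -subr_ge0 /q eqxx.
  rewrite (_ : _ - _ = 2 / (r ^+ 2 * (r + 1))).
    by rewrite divr_ge0 ?mulr_ge0 ?sqr_ge0 // ltW.
  by rewrite /t; field; rewrite !lt0r_neq0.
(* Up to the factor [4 * q n], this is the marginal payoff per unit of [gamma n], so [gamma]
   proportional to [q / d] equalizes the marginals. *)
pose d n := beta + 3 * (1 - beta) * q n.
have bd n : beta <= d n by rewrite lerDl !mulr_ge0 ?subr_ge0 // ltW.
have d0 n : 0 < d n by apply: lt_le_trans (bd n).
pose S : R := \sum_n q n / d n.
have S0 : 0 < S.
  rewrite /S big_ord_recl ltr_wpDr ?divr_gt0 // sumr_ge0 // => n _.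
  by rewrite divr_ge0 // ltW.
have Si0 : 0 <= S^-1 by rewrite invr_ge0 ltW.
pose gamma n := S^-1 * (q n / d n).
have g0 n : 0 < gamma n by rewrite mulr_gt0 ?invr_gt0 ?divr_gt0.
have hbq n : (1 - beta) * q n <= beta.
  have rb : r^-1 <= beta by move: (q0 ord0) hb; rewrite /q eqxx; lra.
  apply: le_trans (le_trans (qr n) rb).
  by rewrite ler_piMl ?ltW //; lra.
have nash : is_pure_nash gamma beta (fun _ : 'I_2 => q).
  apply: (@symmetric_nash _ _ _ _ _ S^-1) => // n; first exact: ltW.
  by rewrite -/(d n) /gamma -mulrA divfK ?lt0r_neq0.
pose n1 : 'I_m.+2 := lift ord0 ord0.
have [||OPT hO WO] := @best_two_pages_optimal _ _ gamma ord0 n1 isT.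
- by move=> n /negPf nn0; rewrite /gamma /d /q nn0.
(* The map [x / (beta + 3 * (1 - beta) * x)] is nondecreasing: after cross-multiplying, the products
   of [t] and [r^-1] cancel. *)
- rewrite (ltW (g0 _)) /= /gamma ler_wpM2l //.
  rewrite ler_pdivrMr // mulrAC ler_pdivlMr // /d /q /=.
  by have := ler_wpM2l (ltW b0) tr; lra.
exists gamma; split=> //.
  by split=> [n|]; rewrite ?ltW // -mulr_sumr mulVf ?lt0r_neq0.
apply: le_trans (pure_PoA_ge _ _ _ _ hO nash).
rewrite lee_fin WO welfare_symmetric.
have W0 : 0 < \sum_n gamma n * q n.
  rewrite big_ord_recl; apply: ltr_wpDr; last exact: mulr_gt0.
  by apply: sumr_ge0 => n _; rewrite ltW // mulr_gt0.
rewrite ler_pdivlMr //.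
(* Dropping [gamma n1] loses at most a factor 2. *)
apply: (@le_trans _ _ (gamma ord0)); last by rewrite lerDl ltW.
have WU : \sum_n gamma n * q n <= S^-1 * (2 / r ^+ 2 / beta).
  apply: (@le_trans _ _ (S^-1 * ((\sum_n q n ^+ 2) / beta))).
    rewrite mulr_suml mulr_sumr; apply: ler_sum => n _.
    rewrite /gamma -mulrA ler_wpM2l // mulrAC -expr2.
    by rewrite ler_wpM2l ?sqr_ge0 // lef_pV2 ?posrE.
  by rewrite ler_wpM2l // ler_wpM2r // invr_ge0 ltW.
apply: (@le_trans _ _ (3^-1 * r * (S^-1 * (2 / r ^+ 2 / beta)))).
  by rewrite ler_wpM2l // mulr_ge0 // ltW.
rewrite mulrCA ler_wpM2l // ler_pdivlMr //.
(* Here the constant 6 matters: [3 * (1 - beta) / r] is at most [beta / 2]. *)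
have dU : d ord0 <= 3 / 2 * beta.
  have : (1 - beta) * r^-1 <= beta / 6.
    apply: (@le_trans _ _ r^-1); last by lra.
    by rewrite ler_piMl ?invr_ge0 ?(ltW r0) //; lra.
  by rewrite /d /q eqxx; lra.
rewrite (_ : q ord0 = 3^-1 * r * (2 / r ^+ 2 / beta) * (3 / 2 * beta)).
  by rewrite ler_wpM2l // !mulr_ge0 ?invr_ge0 ?exprn_ge0 ?(ltW r0) ?(ltW b0).
by rewrite /q eqxx; field; rewrite !lt0r_neq0.
Qed.
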